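(* Let $P$ be a projection algebra. Every maximal subgroup of $\mathsf{PG}(P)$ is isomorphic to a fundamental group of $K_P$, or (equivalently) of $K_P'$. Specifically, the $\mathscr H$-class of any projection $p\in P$ is isomorphic to $\pi_1(K_P,p)\cong\pi_1(K_P',p)$.
   Context: Maps are written to the right of their arguments and composed left to right. A projection algebra is a set $P$ with unary operations $\theta_p:P\to P$ ($p\in P$) such that for all $p,q\in P$: $p\theta_p=p$; $\theta_p\theta_p=\theta_p$; $p\theta_q\theta_p=q\theta_p$; $\theta_p\theta_q\theta_p=\theta_{q\theta_p}$; $\theta_p\theta_q\theta_p\theta_q=\theta_p\theta_q$. On $P$ define $p\leq q$ iff $p=p\theta_q$; $p\leq_{\mathscr F}q$ iff $p=q\theta_p$; $p\mathrel{\mathscr F}q$ iff $p\leq_{\mathscr F}q$ and $q\leq_{\mathscr F}p$. A $P$-path is a tuple $(p_1,\ldots,p_k)$ ($k\geq1$) with $p_1\mathrel{\mathscr F}\cdots\mathrel{\mathscr F}p_k$, regarded as a morphism $p_1\to p_k$; the path category $\mathscr P=\mathscr P(P)$ consists of all $P$-paths under $(p_1,\ldots,p_k)\circ(p_k,\ldots,p_l)=(p_1,\ldots,p_k,\ldots,p_l)$, with identities $(p)$. For $p\in P$, a pair $(e,f)\in P\times P$ is $p$-linked if $f=e\theta_p\theta_f$ and $e=f\theta_p\theta_e$; then $\lambda(e,p,f)=(e,e\theta_p,f)$ and $\rho(e,p,f)=(e,f\theta_p,f)$ are $P$-paths. Let $\approx$ be the (category) congruence on $\mathscr P$ generated by (1)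 all $((p,p),(p))$ with $p\in P$ and (2) all $((p,q,p),(p))$ with $p\mathrel{\mathscr F}q$; let $\equiv$ be the congruence generated by (1), (2) and (3) all $(\lambda(e,p,f),\rho(e,p,f))$ with $p\in P$ and $(e,f)$ $p$-linked. The $\equiv$-class of $(p_1,\ldots,p_k)$ is $[\![p_1,\ldots,p_k]\!]$. The free (projection-generated) regular $*$-semigroup $\mathsf{PG}(P)$ consists of all $\equiv$-classes, with $[\![p_1,\ldots,p_k]\!]^*=[\![p_k,\ldots,p_1]\!]$ and $[\![p_1,\ldots,p_k]\!]\bullet[\![q_1,\ldots,q_l]\!]=[\![p_1',\ldots,p_k',q_1',\ldots,q_l']\!]$, where, with $p'=q_1\theta_{p_k}$ and $q'=p_k\theta_{q_1}$, $p_i'=p'\theta_{p_k}\cdots\theta_{p_i}$ and $q_j'=q'\theta_{q_1}\cdots\theta_{q_j}$. Each $p\in P$ is identified with the projection $[\![p]\!]$. Maximal subgroups of a semigroup $S$ are exactly the $\mathscr H$-classes of idempotents $e$, namely $H_e=\{s\in S: se=es=s\text{ and }st=ts=e\text{ for some }t\in S\}$. A $p$-linked pair $(e,f)$ is special if $e=e\theta_p$ or $f=f\theta_p$ (i.e. $e\leq p$ or $f\leq p$), and degenerate if $\lambda(e,p,f)\approx\rho(e,p,f)$. Write $e'=e\theta_p$ and $f'=f\theta_p$. $G_P$ is the graph with vertex set $P$ and an undirected edge $\{p,q\}$ for each pair of distinct $p,q\in P$ with $p\mathrel{\mathscr F}q$. $K_P$ is the $2$-complex with $1$-skeleton $G_P$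 and a $2$-cell with boundary $(e,e',f,f',e)$ for every $p\in P$ and every $p$-linked pair $(e,f)$ (steps between equal vertices being read as constant). $K_P'$ is the subcomplex of $K_P$ with the same $1$-skeleton and only the $2$-cells corresponding to non-degenerate special $p$-linked pairs $(e,f)$ ($p\in P$); for such a pair, $\{e,f,e',f'\}$ has size $3$, and the cell has boundary $(e,f,f',e)$ if $e\leq p$, and $(e,e',f,e)$ if $f\leq p$. $\pi_1(K,p)$ denotes the fundamental group of $K$ at the vertex $p$. *)

(* Defs.v *)
From HB Require Import structures.
From mathcomp Require Import all_boot.
From mathcomp Require Import boolp classical_sets functions.

Set Implicit Arguments.
Unset Strict Implicit.
Unset Printing Implicit Defensive.

Local Open Scope group_scope.
Local Open Scope quotient_scope.

(* Following the MathComp convention, algebraic structures live on choiceTypes;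
   with the axioms of boolp every type is one, so this loses no generality.
   [act q p] is $q\theta_p$, so that compositions read from left to right. *)
HB.mixin Record isProjAlgebra P of Choice P := {
  act : P -> P -> P;
  act_id : forall p, act p p = p;
  act_idem : forall p x, act (act x p) p = act x p;
  act_swap : forall p q, act (act p q) p = act q p;
  act_conj : forall p q x, act (act (act x p) q) p = act x (act q p);
  act_rep : forall p q x, act (act (act (act x p) q) p) q = act (act x p) q
}.

#[short(type="projAlgebraType")]
HB.structure Definition ProjAlgebra := {P of isProjAlgebra P & Choice P}.

Notation "q \th_ p" := (act q p)
  (at level 40, p at level 2, left associativity, format "q  \th_ p").

(* The morphisms of the category of walks along [r] are the nonempty
   sequences x1 r x2 r ... r xk, from x1 to xk. *)
Section Walks.
Variables (T : choiceType) (r : rel T).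

Definition is_walk (s : seq T) : bool := (s != [::]) && sorted r s.

Definition is_closed_walk (s : seq T) : bool :=
  if s is v :: t then path r v t && (last v t == v) else false.

(* The category congruence generated by [G]. In [cgen_comp], the composite of
   (.., x) and (x, ..) is the sequence in which the shared vertex x appears
   once. *)
Inductive cgen (G : seq T -> seq T -> Prop) : seq T -> seq T -> Prop :=
| cgen_base a b : G a b -> cgen G a b
| cgen_refl a : is_walk a -> cgen G a a
| cgen_sym a b : cgen G a b -> cgen G b a
| cgen_trans a b c : cgen G a b -> cgen G b c -> cgen G a c
| cgen_comp a b x c d : cgen G (rcons a x) (rcons b x) ->
    cgen G (x :: c) (x :: d) -> cgen G (rcons a x ++ c) (rcons b x ++ d).

End Walks.

Section ProjAlgebraTheory.
Variable P : projAlgebraType.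
Implicit Types (p q e f x : P) (s t : seq P).

Definition ple p q : bool := p == p \th_q.
Definition pleF p q : bool := p == q \th_p.
Definition pF : rel P := fun p q => pleF p q && pleF q p.

Definition linked p e f : bool :=
  (f == e \th_p \th_f) && (e == f \th_p \th_e).

Definition lam e p f : seq P := [:: e; e \th_p; f].
Definition rho e p f : seq P := [:: e; f \th_p; f].

Inductive apx_gen : seq P -> seq P -> Prop :=
| apx_id p : apx_gen [:: p; p] [:: p]
| apx_back p q : pF p q -> apx_gen [:: p; q; p] [:: p].

Inductive eqv_gen : seq P -> seq P -> Prop :=
| eqv_apx s t : apx_gen s t -> eqv_gen s t
| eqv_linked p e f : linked p e f -> eqv_gen (lam e p f) (rho e p f).

Definition apx : seq P -> seq P -> Prop := cgen pF apx_gen.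
Definition eqv : seq P -> seq P -> Prop := cgen pF eqv_gen.

Definition special p e f : bool := ple e p || ple f p.
Definition degenerate p e f : Prop := apx (lam e p f) (rho e p f).

Lemma pF_refl p : pF p p.
Proof. by rewrite /pF /pleF act_id eqxx. Qed.

Lemma pF_sym p q : pF p q = pF q p.
Proof. by rewrite /pF andbC. Qed.

Lemma pFP p q : reflect (p = q \th_p /\ q = p \th_q) (pF p q).
Proof. by apply: (iffP andP) => -[/eqP h1 /eqP h2]; split=> //; apply/eqP. Qed.

Lemma linkedP p e f :
  reflect (f = e \th_p \th_f /\ e = f \th_p \th_e) (linked p e f).
Proof. by apply: (iffP andP) => -[/eqP h1 /eqP h2]; split=> //; apply/eqP. Qed.

Lemma linked_sym p e f : linked p e f = linked p f e.
Proof. by rewrite /linked andbC. Qed.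

Lemma pleP p q : reflect (p = p \th_q) (ple p q).
Proof. exact: eqP. Qed.

Lemma ple_act x p : ple (x \th_p) p.
Proof. by apply/pleP; rewrite act_idem. Qed.

Lemma pF_act p q x : pF p q -> ple x p -> pF x (x \th_q).
Proof.
move=> /pFP[hp hq] /pleP hx; apply/pFP; split; last first.
  by rewrite -act_conj -{2}[x]act_id act_rep act_id.
by rewrite act_swap {2}hx -act_conj -hp act_swap -hx.
Qed.

Lemma pF_prod p q : pF (q \th_p) (p \th_q).
Proof.
by apply/pFP; split; rewrite -!act_conj ?act_id !act_swap ?act_idem ?act_swap.
Qed.

Lemma linked_F1 p e f : linked p e f -> pF e (e \th_p).
Proof.
move=> /linkedP[_ he]; set y := f \th_p in he.
have hy : y = y \th_p by rewrite act_idem.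
have py : p \th_y = y by rewrite -act_swap -hy act_id.
have pe : p \th_e = e.
  rewrite [X in p \th_X]he -act_conj [X in _ \th_X \th_ _]hy -act_conj.
  by rewrite act_swap act_conj -hy act_swap -he.
by apply/pFP; split; rewrite ?act_swap -?act_conj ?act_id ?act_swap ?pe.
Qed.

Lemma linked_F2 p e f : linked p e f -> pF (e \th_p) f.
Proof.
move=> h; have /pFP[h1 _] := linked_F1 h; move/linkedP: h => [hf he].
by apply/pFP; split=> //; rewrite -act_conj -he.
Qed.

Lemma lam_walk p e f : linked p e f -> is_walk pF (lam e p f).
Proof. by move=> h; rewrite /is_walk /= (linked_F1 h) (linked_F2 h). Qed.

Lemma rho_walk p e f : linked p e f -> is_walk pF (rho e p f).
Proof.
rewrite linked_sym => h.
by rewrite /is_walk /= pF_sym (linked_F2 h) /= pF_sym (linked_F1 h).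
Qed.

Lemma eqv_gen_walk s t : eqv_gen s t -> is_walk pF s /\ is_walk pF t.
Proof.
case=> [_ _ [p|p q pq]|p e f h].
- by rewrite /is_walk /= pF_refl.
- by rewrite /is_walk /= pq pF_sym pq.
- by rewrite lam_walk // rho_walk.
Qed.

(* For s = (p1, .., pk) and t = (q1, .., ql), with p' = q1 \th_pk and
   q' = pk \th_q1, [prodl p' s] is (p1', .., pk') with
   pi' = p' \th_pk .. \th_pi, and [prodr q' t] is (q1', .., ql') with
   qj' = q' \th_q1 .. \th_qj. *)
Definition prodr x t : seq P := scanl act x t.
Definition prodl x s : seq P := rev (prodr x (rev s)).

Definition prods s t : seq P :=
  if s is p1 :: s' then
    if t is q1 :: _ then
      let pk := last p1 s' in prodl (q1 \th_pk) s ++ prodr (pk \th_q1) t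
    else [::]
  else [::].

Lemma prodr_walk x q t :
  ple x q -> path pF q t -> path pF x (prodr x t).
Proof.
elim: t x q => //= q' t IH x q hx /andP[qq' ht].
rewrite (pF_act qq' hx) /=; exact: IH (ple_act _ _) ht.
Qed.

Lemma prodr_cons x q t : ple x q -> prodr x (q :: t) = x :: prodr x t.
Proof. by move=> /pleP h; rewrite /prodr /= -h. Qed.

Lemma prodr_cat x s t : prodr x (s ++ t) = prodr x s ++ prodr (foldl act x s) t.
Proof. exact: scanl_cat. Qed.

Lemma prodr_rcons x s y :
  prodr x (rcons s y) = rcons (prodr x s) (foldl act x (rcons s y)).
Proof. by rewrite -!cats1 prodr_cat foldl_cat. Qed.

Lemma is_walk_rev s : is_walk pF (rev s) = is_walk pF s.
Proof.
rewrite /is_walk -!size_eq0 size_rev rev_sorted; congr (_ && _).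
by case: s => //= x s; apply: eq_path => y z; rewrite pF_sym.
Qed.

Lemma prodsE a p q c (p' := q \th_p) (q' := p \th_q) :
  prods (rcons a p) (q :: c) = rcons (rev (prodr p' (rev a))) p' ++ q' :: prodr q' c.
Proof.
have -> : prods (rcons a p) (q :: c) = prodl p' (rcons a p) ++ prodr q' (q :: c).
  by case: a => [|x a] //; rewrite /prods rcons_cons; cbv beta iota zeta; rewrite last_rcons.
rewrite /prodl rev_rcons !prodr_cons ?ple_act //.
by rewrite rev_cons.
Qed.

Lemma prods_walk s t : is_walk pF s -> is_walk pF t -> is_walk pF (prods s t).
Proof.
case/lastP: s => // a p; rewrite -is_walk_rev rev_rcons => /andP[_ /= ha].
case: t => // q c /andP[_ /= hc]; rewrite prodsE.
rewrite /is_walk sorted_cat_cons (prodr_walk (ple_act _ _) hc) andbT.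
rewrite -size_eq0 size_cat /= addnS /=.
have := prodr_walk (ple_act q p) ha; set p' := q \th_p; set u := prodr _ _ => hu.
have : is_walk pF (rev (p' :: u)) by rewrite is_walk_rev.
rewrite /is_walk => /andP[_]; rewrite rev_cons.
case: (rev u) => [|z w] /=; first by rewrite pF_prod.
by move=> h; rewrite rcons_path last_rcons pF_prod h.
Qed.


Lemma eqv_gen_ends s t : eqv_gen s t ->
  [/\ is_walk pF s, is_walk pF t & forall z, head z s = head z t /\ last z s = last z t].
Proof. by move=> h; have [? ?] := eqv_gen_walk h; split=> // z; case: h => [_ _ []|]. Qed.

Lemma eqv_ends s t : eqv s t ->
  [/\ is_walk pF s, is_walk pF t & forall z, head z s = head z t /\ last z s = last z t].
Proof.
elim=> {s t} [s t /eqv_gen_ends//|//|s t _ [hs ht h]|s t u _ [hs ht h] _ [_ hu k]|].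
- by split=> // z; have [-> ->] := h z.
- by split=> // z; have [-> ->] := h z.
move=> a b x c d _ [ha hb h] _ [hc hd k].
have aux u v : is_walk pF (rcons u x) -> is_walk pF (x :: v) -> is_walk pF (rcons u x ++ v).
  rewrite /is_walk cat_rcons sorted_cat_cons => /andP[_ ->] /andP[_ /= ->].
  by rewrite -size_eq0 size_cat addnS.
split; [exact: aux|exact: aux|] => z; split.
  by have [] := h z; case: (a) => [|? ?]; case: (b).
by rewrite !last_cat !last_rcons; have [] := k z.
Qed.

Lemma eqv_prodr x s t : eqv s t -> ple x (head x s) -> eqv (prodr x s) (prodr x t).
Proof.
move=> h; elim: h x => {s t} [s t hst|s hs|s t h IH|s t u h IH k IH'|a b y c d h IH k IH'] x.
- case: hst => [_ _ [p|p q pq]|p e f hl]; rewrite [head _ _]/= => hx.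
  + by rewrite /prodr /= -!(eqP hx); apply/cgen_base/eqv_apx/apx_id.
  + have xq := pF_act pq hx; have [xqp _] := pFP _ _ xq.
    have [hp _] := pFP _ _ pq.
    have -> : prodr x [:: p; q; p] = [:: x; x \th_q; x].
      rewrite /prodr /= -(eqP hx); congr [:: _; _; _].
      by rewrite {1}(eqP hx) act_conj -hp -(eqP hx).
    by rewrite /prodr /= -(eqP hx); apply/cgen_base/eqv_apx/apx_back.
  + have [hf he] := linkedP _ _ _ hl; have hxe := eqP hx.
    set f1 := x \th_p \th_f.
    have E1 : x \th_(e \th_p) = x \th_p.
      by rewrite -act_conj {1}hxe act_rep -hxe.
    have E2 : x \th_(f \th_p) = f1 \th_p by rewrite -act_conj.
    have E3 : x \th_(f \th_p) \th_f = f1 by rewrite -act_conj act_rep.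
    have -> : prodr x (lam e p f) = lam x p f1.
      by rewrite /prodr /lam /= -hxe E1.
    have -> : prodr x (rho e p f) = rho x p f1.
      by rewrite /prodr /rho /= -hxe E3 E2.
    apply/cgen_base/eqv_linked/linkedP; split.
      have : pF (x \th_p) f1.
        apply: (@pF_act (e \th_p)); first exact: linked_F2 hl.
        by rewrite -E1 ple_act.
      by case/pFP.
    have : pF x (f1 \th_p).
      rewrite -E2; apply: (@pF_act e) => //.
      by rewrite pF_sym; apply: linked_F2; rewrite linked_sym.
    by case/pFP.
- move=> hx; apply: cgen_refl; case: s hs hx => // q s /andP[_ hs] hx.
  by rewrite (prodr_cons s hx) /is_walk /=; apply: prodr_walk hx hs.
- have [_ _ /(_ x)[hd _]] := eqv_ends h.
  by rewrite -hd => /IH; apply: cgen_sym.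
- have [_ _ /(_ x)[hd _]] := eqv_ends h => hx.
  by apply: cgen_trans (IH _ hx) (IH' _ _); rewrite -hd.
- have [_ _ /(_ x)[hd _]] := eqv_ends h => hx.
  have hxa : ple x (head x (rcons a y)) by case: (a) hx.
  have hab := IH x hxa; rewrite !prodr_cat; rewrite !prodr_rcons in hab *.
  have [_ _ /(_ x)[_]] := eqv_ends hab; rewrite !last_rcons => ll'.
  rewrite -ll' in hab *; apply: cgen_comp => //.
  have hly : ple (foldl act x (rcons a y)) y by rewrite foldl_rcons ple_act.
  by have := IH' _ hly; rewrite !prodr_cons.
Qed.

Lemma eqv_rev s t : eqv s t -> eqv (rev s) (rev t).
Proof.
elim=> {s t} [_ _ [_ _ [p|p q pq]|p e f hl]|s hs|s t _|s t u _ h _|a b x c d _ h _ k].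
- exact/cgen_base/eqv_apx/apx_id.
- exact/cgen_base/eqv_apx/apx_back.
- by apply/cgen_sym/cgen_base/(@eqv_linked p f e); rewrite linked_sym.
- by apply: cgen_refl; rewrite is_walk_rev.
- exact: cgen_sym.
- exact: cgen_trans.
- rewrite !cat_rcons !rev_cat !rev_cons; apply: cgen_comp.
    by rewrite -!rev_cons.
  by rewrite -!rev_rcons.
Qed.

Lemma eqv_prods s s' t t' : eqv s s' -> eqv t t' -> eqv (prods s t) (prods s' t').
Proof.
move=> hs ht; have [ws ws' es] := eqv_ends hs; have [wt wt' et] := eqv_ends ht.
case/lastP: s hs ws es => // a p hs _ /(_ p)[_].
case/lastP: s' hs ws' => // a' p' hs _; rewrite !last_rcons => pp'.
rewrite -{p'}pp' in hs *.
case: t ht wt et => // q c ht _ /(_ q)[+ _].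
case: t' ht wt' => // q' c' ht _ /= qq'; rewrite -{q'}qq' in ht *.
rewrite !prodsE; set p1 := q \th_p; set q1 := p \th_q.
have h1 : eqv (rcons (rev (prodr p1 (rev a))) p1) (rcons (rev (prodr p1 (rev a'))) p1).
  have h : eqv (rev (rcons a p)) (rev (rcons a' p)) := eqv_rev hs.
  have := eqv_prodr h (x := p1); rewrite !rev_rcons [head _ _]/= ple_act => /(_ isT).
  by rewrite !prodr_cons ?ple_act // => /eqv_rev; rewrite !rev_cons.
have h2 : eqv (q1 :: prodr q1 c) (q1 :: prodr q1 c').
  have := eqv_prodr ht (x := q1); rewrite [head _ _]/= ple_act => /(_ isT).
  by rewrite !prodr_cons ?ple_act.
apply: cgen_comp => //.
apply: (@cgen_comp _ _ _ [:: p1] [:: p1] q1) => //.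
by apply: cgen_refl; rewrite /is_walk /= pF_prod.
Qed.

Lemma prods_act a p q c :
  prods (rcons a p) (q :: c) = prodl q (rcons a p) ++ prodr p (q :: c).
Proof.
rewrite prodsE /prodl rev_rcons -[prodr q _]/(_ :: prodr _ _) rev_cons.
by rewrite -[prodr p _]/(_ :: prodr _ _).
Qed.

Lemma prodr_prodr x y s : ple x y -> prodr x (prodr y s) = prodr x s.
Proof.
elim: s x y => // q s IH x y /pleP hx.
have E : x \th_(y \th_q) = x \th_q by rewrite -act_conj {1}hx act_rep -hx.
rewrite -[LHS]/(_ :: prodr _ (prodr _ _)) -[RHS]/(_ :: prodr _ _) E; congr (_ :: _).
by apply: IH; rewrite -E ple_act.
Qed.

Lemma act_foldl_prodr x p y :
  foldl act x (rev (prodr p y)) \th_p = foldl act x (rev y) \th_p.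
Proof.
elim: y p => // q y IH p; rewrite -[prodr p _]/(_ :: prodr _ _).
by rewrite !rev_cons !foldl_rcons IH -act_conj act_rep.
Qed.

Lemma linked_act x p q : linked q (x \th_q \th_p) (p \th_q \th_x).
Proof.
have aux u v : v \th_q \th_u = u \th_q \th_v \th_q \th_(v \th_q \th_u).
  by rewrite (act_conj q v u) -[RHS]act_conj act_rep act_swap.
by apply/linkedP; split; apply: aux.
Qed.

Lemma lam_act x p q : let e := x \th_q \th_p in let f := p \th_q \th_x in
  lam e q f = [:: e; x \th_(p \th_q); f] /\ rho e q f = [:: e; p \th_(x \th_q); f].
Proof. by rewrite /lam /rho /= !act_conj. Qed.

Lemma eqv_mid p x y (e := foldl act x (rev y) \th_p) (f := foldl act p y \th_x) :
  is_walk pF y ->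
  eqv (e :: rcons (prodl x (prodr p y)) f) (e :: rcons (prodr p (prodl x y)) f).
Proof.
rewrite {}/e {}/f; elim: y p => // q [|q2 y] IH p hy.
  have [<- <-] := lam_act x p q.
  by apply/cgen_base/eqv_linked/linked_act.
have {}/IH IH : is_walk pF (q2 :: y) by move: hy => /andP[_ /andP[]].
set y' := q2 :: y in hy IH *.
set h := foldl act x (rev y') in IH *.
have Eh : foldl act x (rev (q :: y')) = h \th_q by rewrite rev_cons foldl_rcons.
set q' := p \th_q; set f := foldl act q' y' \th_x.
rewrite Eh.
have -> : prodl x (prodr p (q :: y')) = h \th_q' :: prodl x (prodr q' y').
  rewrite -[prodr p _]/(q' :: prodr q' y') /prodl rev_cons prodr_rcons rev_rcons.
  by rewrite foldl_rcons act_foldl_prodr.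
have Ey : prodl x (q :: y') = h \th_q :: prodl x y'.
  by rewrite /prodl rev_cons prodr_rcons rev_rcons foldl_rcons.
have [w Ew] : exists w, prodl x y' = h :: w.
  by exists (prodl x y); rewrite /h /prodl rev_cons prodr_rcons rev_rcons.
set f1 := q' \th_h.
rewrite Ey Ew; have := IH q'; rewrite -/f Ew.
have -> : prodr q' (h :: w) = f1 :: prodr f1 w by [].
move=> IH'.
have -> : prodr p [:: h \th_q, h & w] = p \th_(h \th_q) :: f1 :: prodr f1 w.
  have E : p \th_(h \th_q) \th_h = f1 by rewrite -act_conj act_rep.
  by rewrite -E.
have [L1 R1] := lam_act h p q.
have LR : eqv [:: h \th_q \th_p; h \th_q'; f1] [:: h \th_q \th_p; p \th_(h \th_q); f1].
  by rewrite -L1 -R1; apply/cgen_base/eqv_linked/linked_act.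
have [hl _ _] := eqv_ends LR; have [_ hr _] := eqv_ends IH'.
set e := h \th_q \th_p in LR hl *.
apply: (@cgen_trans _ _ _ _ [:: e, h \th_q' , f1 & rcons (prodr f1 w) f]).
  apply: (@cgen_comp _ _ _ [:: e] [:: e] (h \th_q') _ _) => //.
  by apply: cgen_refl; move: hl; rewrite /is_walk /= => /andP[->].
apply: (@cgen_comp _ _ _ [:: e; h \th_q'] [:: e; p \th_(h \th_q)] f1) => //.
by apply: cgen_refl; move: hr => /andP[_ /= /andP[]].
Qed.

Lemma prodl_cat x s t : prodl x (s ++ t) = prodl (foldl act x (rev t)) s ++ prodl x t.
Proof. by rewrite /prodl rev_cat prodr_cat rev_cat. Qed.

Lemma prodr_prodr_act x p q y a :
  prodr (foldl act x (rev (prodr p (q :: y)))) (prodr q (p :: a)) =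
  prodr (foldl act x (rev (q :: y))) (p :: a).
Proof.
set g := foldl _ _ _; set h := foldl _ _ _.
have gh : g \th_p = h \th_p by apply: act_foldl_prodr.
have hg : g = g \th_(p \th_q).
  rewrite /g -[prodr p _]/(_ :: prodr _ _) rev_cons foldl_rcons.
  by rewrite act_idem.
rewrite -[prodr q _]/(q \th_p :: prodr _ a) -[RHS]/(h \th_p :: prodr _ a) -gh.
have E : g \th_(q \th_p) = g \th_p.
  by rewrite -act_conj [in LHS]hg [in RHS]hg -!act_conj !act_rep.
rewrite -[LHS]/(_ :: prodr _ (prodr _ a)) E prodr_prodr //.
by rewrite -E ple_act.
Qed.

Lemma prods_assoc s t u : is_walk pF s -> is_walk pF t -> is_walk pF u ->
  eqv (prods (prods s t) u) (prods s (prods t u)).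
Proof.
move=> hs ht hu; have hl := prods_walk (prods_walk hs ht) hu.
case/lastP: s hs hl => // a p _ hl.
case: t ht hl => // q y ht hl; case: u hu hl => // z c _ hl.
set Y := q :: y in ht hl *; pose h := foldl act z (rev Y).
pose t := foldl act p Y.
have [y1 [r Ey]] : exists y1 r, Y = rcons y1 r.
  by exists (belast q y), (last q y); rewrite -lastI.
have El : prods (prods (rcons a p) Y) (z :: c) =
    prodl h (rcons a p) ++ prodl z (prodr p Y) ++ prodr t (z :: c).
  have Et : prodr p Y = rcons (prodr p y1) t by rewrite /t Ey prodr_rcons.
  rewrite prods_act Et -rcons_cat prods_act rcons_cat -Et.
  rewrite prodl_cat -catA; congr (_ ++ _).
  by rewrite /prodl revK rev_rcons prodr_prodr_act.
have Er : prods (rcons a p) (prods Y (z :: c)) =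
    prodl h (rcons a p) ++ prodr p (prodl z Y) ++ prodr t (z :: c).
  rewrite [in prods Y _]Ey prods_act -Ey.
  have [w Ew] : exists w, prodl z Y = h :: w.
    exists (prodl z y); rewrite /prodl rev_cons prodr_rcons rev_rcons.
    by rewrite /h rev_cons.
  rewrite Ew cat_cons prods_act -cat_cons -Ew prodr_cat; congr (_ ++ (_ ++ _)).
  have := prodr_prodr_act p z r (rev y1) c.
  by rewrite -rev_rcons -Ey revK.
have eF := eqv_mid p z ht; rewrite -/h -/t in eF.
rewrite El Er in hl *.
have EA : prodl h (rcons a p) = rcons (prodl (h \th_p) a) (h \th_p).
  by rewrite /prodl rev_rcons -[prodr h _]/(_ :: prodr _ _) rev_cons.
have EC : prodr t (z :: c) = t \th_z :: prodr (t \th_z) c by [].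
rewrite EA EC in hl *.
move: hl; rewrite catA /is_walk sorted_cat_cons => /andP[_ /andP[hl hC]].
rewrite -catA; apply: cgen_comp.
  apply: cgen_refl; rewrite /is_walk -size_eq0 size_rcons /=.
  by move: hl; rewrite rcons_cat => /cat_sorted2[].
rewrite -!cat_rcons -!cat_cons.
by apply: (@cgen_comp _ _ _ (_ :: _) (_ :: _)) => //; exact: cgen_refl.
Qed.

End ProjAlgebraTheory.

Section PG.
Variable P : projAlgebraType.

Record ppath := PPath { ppath_seq :> seq P; ppathP : is_walk (@pF P) ppath_seq }.

HB.instance Definition _ := [isSub for ppath_seq].
HB.instance Definition _ := [Choice of ppath by <:].

Definition ppath_eqv (s t : ppath) : bool := `[< eqv s t >].

Lemma ppath_eqv_refl : reflexive ppath_eqv.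
Proof. by move=> s; apply/asboolP/cgen_refl/ppathP. Qed.

Lemma ppath_eqv_sym : symmetric ppath_eqv.
Proof. by move=> s t; apply/asboolP/asboolP; apply: cgen_sym. Qed.

Lemma ppath_eqv_trans : transitive ppath_eqv.
Proof. by move=> s t u /asboolP st /asboolP tu; apply/asboolP/(cgen_trans st tu). Qed.

Canonical ppath_equiv :=
  EquivRel ppath_eqv ppath_eqv_refl ppath_eqv_sym ppath_eqv_trans.

Definition PG := {eq_quot ppath_eqv}.
HB.instance Definition _ := EqQuotient.on PG.
HB.instance Definition _ := Choice.on PG.

Definition ppath_prod (s t : ppath) : ppath :=
  PPath (prods_walk (ppathP s) (ppathP t)).

Definition PG_mul (x y : PG) : PG := \pi_PG (ppath_prod (repr x) (repr y)).

Lemma PG_mul_pi (s t : ppath) :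
  PG_mul (\pi_PG s) (\pi_PG t) = \pi_PG (ppath_prod s t).
Proof.
have aux s' : eqv (repr (\pi_PG s')) s'.
  suff /asboolP : ppath_eqv (repr (\pi_PG s')) s' by [].
  by apply/eqmodP; rewrite reprK.
by apply/eqmodP/asboolP/eqv_prods; apply: aux.
Qed.

Lemma PG_mulA : associative PG_mul.
Proof.
elim/quotW => s; elim/quotW => t; elim/quotW => u.
rewrite (PG_mul_pi t u) (PG_mul_pi s t) !PG_mul_pi.
apply/esym/eqmodP/asboolP; by apply: prods_assoc; apply: ppathP.
Qed.

HB.instance Definition _ := isSemigroup.Build PG PG_mulA.

Lemma ppath1_subproof (p : P) : is_walk (@pF P) [:: p].
Proof. by []. Qed.

Definition PG_proj (p : P) : PG := \pi_PG (PPath (ppath1_subproof p)).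

End PG.

(* Combinatorial 2-complexes: a simple graph together with 2-cells attached
   along closed edge paths. *)
Record complex2 := Complex2 {
  vertex :> choiceType;
  edge : rel vertex;
  edge_sym : symmetric edge;
  edge_irr : irreflexive edge;
  cell : Type;
  bdry : cell -> seq vertex;
  bdryP : forall c, is_closed_walk edge (bdry c)
}.

Definition subcomplex2 (K : complex2) (D : cell K -> Prop) : complex2 :=
  @Complex2 K (@edge K) (@edge_sym K) (@edge_irr K) {c : cell K | D c}
    (fun c => bdry (sval c)) (fun c => bdryP (sval c)).

(* The fundamental group is the edge-path group: closed edge paths at v modulo
   the category congruence generated by backtracks and boundaries of 2-cells. *)
Section FundamentalGroup.
Variable K : complex2.
Implicit Types (v : K) (s t u : seq K).

Inductive htpy_gen : seq K -> seq K -> Prop :=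
| htpy_back v w : edge v w -> htpy_gen [:: v; w; v] [:: v]
| htpy_cell (c : cell K) v t : bdry c = v :: t -> htpy_gen (v :: t) [:: v].

Definition htpy : seq K -> seq K -> Prop := cgen (@edge K) htpy_gen.

Section BasePoint.
Variable v : K.

(* A loop v, x1, .., xk = v is stored as (x1, .., xk). *)
Record loop := Loop {
  loop_seq :> seq K;
  loopP : path (@edge K) v loop_seq && (last v loop_seq == v)
}.

HB.instance Definition _ := [isSub for loop_seq].
HB.instance Definition _ := [Choice of loop by <:].

Definition loop_htpy (s t : loop) : bool := `[< htpy (v :: s) (v :: t) >].

Lemma loop_htpy_refl : reflexive loop_htpy.
Proof. by move=> s; apply/asboolP/cgen_refl; case/andP: (loopP s). Qed.

Lemma loop_htpy_sym : symmetric loop_htpy.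
Proof. by move=> s t; apply/asboolP/asboolP; apply: cgen_sym. Qed.

Lemma loop_htpy_trans : transitive loop_htpy.
Proof. by move=> s t u /asboolP st /asboolP tu; apply/asboolP/(cgen_trans st tu). Qed.

Canonical loop_equiv :=
  EquivRel loop_htpy loop_htpy_refl loop_htpy_sym loop_htpy_trans.

Definition pi1 := {eq_quot loop_htpy}.
HB.instance Definition _ := EqQuotient.on pi1.
HB.instance Definition _ := Choice.on pi1.

Lemma loop1_subproof : path (@edge K) v [::] && (last v [::] == v).
Proof. by rewrite /= eqxx. Qed.

Lemma loopM_subproof (s t : loop) :
  path (@edge K) v (s ++ t) && (last v (s ++ t) == v).
Proof.
case/andP: (loopP s) => ps /eqP ls; case/andP: (loopP t) => pt lt.
by rewrite cat_path last_cat ls ps pt.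
Qed.

Lemma loopV_subproof (s : loop) :
  path (@edge K) v (behead (rev (v :: s))) &&
  (last v (behead (rev (v :: s))) == v).
Proof.
case/andP: (loopP s) => ps /eqP ls.
have E : rev (v :: s) = v :: rev (belast v s) by rewrite lastI rev_rcons ls.
rewrite E /= -{1}ls rev_path; apply/andP; split.
  by rewrite (eq_path (e' := @edge K)) // => x y; apply: edge_sym.
by case: (s : seq K) ls => //= x s' _; rewrite rev_cons last_rcons.
Qed.

Definition loop1 := Loop loop1_subproof.
Definition loopM (s t : loop) := Loop (loopM_subproof s t).
Definition loopV (s : loop) := Loop (loopV_subproof s).

Definition pi1_one : pi1 := \pi_pi1 loop1.
Definition pi1_mul (x y : pi1) : pi1 := \pi_pi1 (loopM (repr x) (repr y)).
Definition pi1_inv (x : pi1) : pi1 := \pi_pi1 (loopV (repr x)).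

Lemma loopE (s : loop) : v :: s = rcons (belast v s) v.
Proof. by case/andP: (loopP s) => _ /eqP {3}<-; rewrite lastI. Qed.

Lemma loopVE (s : loop) : v :: loopV s = rev (v :: s).
Proof. by rewrite /= loopE rev_rcons. Qed.

Lemma pi1_mul_pi (s t : loop) :
  pi1_mul (\pi_pi1 s) (\pi_pi1 t) = \pi_pi1 (loopM s t).
Proof.
set s' := repr (\pi_pi1 s); set t' := repr (\pi_pi1 t).
have /asboolP hs : loop_htpy s' s by apply/eqmodP; exact: reprK.
have /asboolP ht : loop_htpy t' t by apply/eqmodP; exact: reprK.
apply/eqmodP/asboolP; rewrite /= -!cat_cons !loopE.
by apply: cgen_comp => //; rewrite -!loopE.
Qed.

Lemma pi1_mulA : associative pi1_mul.
Proof.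
elim/quotW => s; elim/quotW => t; elim/quotW => u.
rewrite (pi1_mul_pi t u) (pi1_mul_pi s t) !pi1_mul_pi.
by congr (\pi_pi1 _); apply: val_inj; apply: catA.
Qed.

Lemma pi1_mul1l : left_id pi1_one pi1_mul.
Proof.
elim/quotW => s; rewrite pi1_mul_pi.
by congr (\pi_pi1 _); apply: val_inj.
Qed.

Lemma pi1_mul1r : right_id pi1_one pi1_mul.
Proof.
elim/quotW => s; rewrite pi1_mul_pi.
by congr (\pi_pi1 _); apply: val_inj; apply: cats0.
Qed.

Lemma htpy_cancel (u : K) s :
  path (@edge K) u s -> htpy (u :: s ++ behead (rev (u :: s))) [:: u].
Proof.
elim: s u => [|w s IH] u /=; first by move=> _; apply: cgen_refl.
move=> /andP[uw /IH h].
have -> : behead (rev [:: u, w & s]) = rcons (behead (rev (w :: s))) u.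
  by rewrite rev_cons; case/lastP: s {IH h} => // s z; rewrite -rcons_cons rev_rcons.
have uwu : htpy [:: u; w; u] [:: u] by apply/cgen_base/htpy_back.
apply: cgen_trans uwu; rewrite -rcons_cat.
have [a Ea] : exists a, w :: s ++ behead (rev (w :: s)) = rcons a w.
  exists (belast w s ++ rev s); rewrite -cat_cons lastI rev_rcons /=.
  by rewrite cat_rcons -rev_rcons -lastI rev_cons rcons_cat.
rewrite Ea in h; rewrite -rcons_cons Ea -[rcons _ u]cats1 -cat_cons -rcons_cons.
have hwu : htpy [:: w; u] [:: w; u].
  by apply: cgen_refl; rewrite /is_walk /= edge_sym uw.
apply: (@cgen_comp _ _ _ (u :: a) [:: u] w [:: u] [:: u]) => //.
rewrite rcons_cons -Ea; apply: (@cgen_comp _ _ _ [:: u] [:: u] w) => //.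
  by apply: cgen_refl; rewrite /is_walk /= uw.
by rewrite Ea.
Qed.

Lemma loop_cancel (s : loop) : htpy (v :: s ++ loopV s) [:: v].
Proof. by case/andP: (loopP s) => /htpy_cancel. Qed.

Lemma loopVK (s : loop) : loopV (loopV s) = s.
Proof. by apply: val_inj; rewrite /= loopVE revK. Qed.

Lemma pi1_mulr_inv : right_inverse pi1_one pi1_inv pi1_mul.
Proof.
elim/quotW => s; rewrite /pi1_inv -[X in pi1_mul X _]reprK pi1_mul_pi.
by apply/eqmodP/asboolP/loop_cancel.
Qed.

Lemma pi1_mull_inv : left_inverse pi1_one pi1_inv pi1_mul.
Proof.
elim/quotW => s; rewrite /pi1_inv -[X in pi1_mul _ X]reprK pi1_mul_pi.
set t := repr _; rewrite -[X in loopM _ X]loopVK.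
by apply/eqmodP/asboolP/loop_cancel.
Qed.

HB.instance Definition _ :=
  isGroup.Build pi1 pi1_mulA pi1_mul1l pi1_mul1r pi1_mull_inv pi1_mulr_inv.

End BasePoint.
End FundamentalGroup.

Arguments pi1 : clear implicits.

Section ComplexKP.
Variable P : projAlgebraType.
Implicit Types (p q e f v : P) (s : seq P).

Definition GP_edge : rel P := fun p q => (p != q) && pF p q.

Lemma GP_edge_sym : symmetric GP_edge.
Proof. by move=> p q; rewrite /GP_edge eq_sym pF_sym. Qed.

Lemma GP_edge_irr : irreflexive GP_edge.
Proof. by move=> p; rewrite /GP_edge eqxx. Qed.

(* [nostutter v s] removes from s the constant steps of the walk v :: s. *)
Fixpoint nostutter v s : seq P :=
  if s is w :: s' then
    if w == v then nostutter v s' else w :: nostutter w s'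
  else [::].

Lemma nostutter_path v s : path (@pF P) v s ->
  path GP_edge v (nostutter v s) && (last v (nostutter v s) == last v s).
Proof.
elim: s v => [|w s IH] v /=; first by rewrite eqxx.
case: (eqVneq w v) => [->|wv] /andP[vw /IH] //=.
by have -> : GP_edge v w by rewrite /GP_edge eq_sym wv vw.
Qed.

Record linked_pair := LinkedPair {
  lk_p : P; lk_e : P; lk_f : P;
  lk_linked : linked lk_p lk_e lk_f
}.

Definition KP_bdry (c : linked_pair) : seq P :=
  lk_e c :: nostutter (lk_e c) [:: lk_e c \th_(lk_p c); lk_f c; lk_f c \th_(lk_p c); lk_e c].

Lemma KP_bdryP (c : linked_pair) : is_closed_walk GP_edge (KP_bdry c).
Proof.
case: c => p e f h; have h' : linked p f e by rewrite linked_sym.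
apply: (@nostutter_path e [:: e \th_p; f; f \th_p; e]).
by rewrite /= (linked_F1 h) (linked_F2 h) (linked_F1 h') (linked_F2 h').
Qed.

Definition KP : complex2 := Complex2 GP_edge_sym GP_edge_irr KP_bdryP.

Definition KP' : complex2 :=
  @subcomplex2 KP (fun c : linked_pair =>
    special (lk_p c) (lk_e c) (lk_f c) /\ ~ degenerate (lk_p c) (lk_e c) (lk_f c)).

(* The cells of KP' are triangles: their boundaries, inherited from KP, are
   (e, f, f', e) if e <= p, and (e, e', f, e) if f <= p. *)
Lemma KP'_bdry (c : cell KP') (p := lk_p (sval c)) (e := lk_e (sval c))
    (f := lk_f (sval c)) :
  if ple e p then bdry c = [:: e; f; f \th_p; e] /\ uniq [:: e; f; f \th_p]
  else bdry c = [:: e; e \th_p; f; e] /\ uniq [:: e; e \th_p; f].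
Proof.
rewrite {}/p {}/e {}/f; case: c => -[p e f h] [/= hs hd].
rewrite /bdry /= /KP_bdry; cbn [lk_p lk_e lk_f sval].
have deg2 : lam e p f = rho e p f -> False.
  by move=> E; apply: hd; rewrite /degenerate E; apply/cgen_refl/rho_walk.
have eef : pF e f -> apx [:: e; e; f] [:: e; f; f].
  move=> ef; have wef : is_walk (@pF P) [:: e; f] by rewrite /is_walk /= ef.
  apply: (@cgen_trans _ _ _ _ [:: e; f]).
    apply: (@cgen_comp _ _ _ [:: e] [::] e [:: f] [:: f]); last exact: cgen_refl.
    exact/cgen_base/apx_id.
  apply: (@cgen_comp _ _ _ [:: e] [:: e] f [::] [:: f]); first exact: cgen_refl.
  exact/cgen_sym/cgen_base/apx_id.
case: ifP => hep.
  have ee : e \th_p = e by rewrite -(eqP hep).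
  have n1 : e != f by apply/eqP => E; apply: deg2; rewrite -E /lam /rho.
  have n2 : f \th_p != f.
    apply/eqP => E; apply: hd; rewrite /degenerate /lam /rho ee E.
    by apply: eef; rewrite -{1}ee; apply: linked_F2.
  have n3 : e != f \th_p by apply/eqP => E; apply: deg2; rewrite /lam /rho ee -E.
  rewrite ee /= eqxx eq_sym (negPf n1) (negPf n2) (negPf n3) !inE.
  by rewrite (negPf n1) (negPf n3) eq_sym (negPf n2).
have hfp : ple f p by move: hs; rewrite /special hep.
have ff : f \th_p = f by rewrite -(eqP hfp).
have n1 : e \th_p != e by rewrite eq_sym -/(ple e p) hep.
have n2 : f != e \th_p by apply/eqP => E; apply: deg2; rewrite /lam /rho ff -E.
have n3 : e != f by apply/eqP => E; move: hep; rewrite E hfp.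
rewrite ff /= (negPf n1) (negPf n2) eqxx (negPf n3) !inE.
by rewrite eq_sym (negPf n1) (negPf n3) eq_sym (negPf n2).
Qed.

End ComplexKP.

Definition Hclass (S : semigroupType) (e : S) : set S :=
  [set s | s * e = s /\ e * s = s /\ exists t, s * t = e /\ t * s = e].

Definition maximal_subgroup (S : semigroupType) (A : set S) : Prop :=
  exists2 e : S, e * e = e & A = Hclass e.

Definition group_iso (G H : groupType) : Prop :=
  exists f : {multiplicative G -> H}, bijective f.

(* The group G is isomorphic to the subset A of S under the product of S. *)
Definition group_iso_sub (G : groupType) (S : semigroupType) (A : set S) : Prop :=
  exists f : {multiplicative G -> S}, set_bij [set: G] A f.

(* Main.v *)
From HB Require Import structures.
Require Import Defs.
From mathcomp Require Import all_boot.
From mathcomp Require Import boolp classical_sets functions.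

(** The classes of P-paths from p to p form, under composition in the category
    of P-paths modulo the congruence of PG(P), a group, and this group is the
    H-class of the projection p: the product of PG(P) restricts to composition
    on composable paths ([PG_mul_join]), and since the ends of a product lie
    below the ends of its factors ([prods_ends]), an element that p fixes on
    both sides and that divides p must start and end at p
    ([Hclass_proj_ends]).

    It remains to compare this group with edge-path groups.  A P-path may
    repeat a vertex where an edge path may not, but removing the repetitions
    ([unstutter]) stays in the same class.  In K_P the cell of a linked pair
    (e, f) says exactly that the two halves (e, e', f) and (e, f', f) of its
    boundary are homotopic, which is the defining relation of PG(P), while the
    relation on backtracks is common to both sides.  For K_P' one needs that the
    remaining cells suffice: if (e, f) is p-linked then so are (e', f) and
    (e, f'), both special, and their triangles are the halves of the square
    (e, e', f, f') cut along the diagonal e' - f' ([linked_special],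
    [linked_htpy]); the triangle of a degenerate pair is already contractible in
    the graph.  So for both complexes two edge paths are homotopic if and only
    if they are equal in PG(P) ([htpy_eqv], [eqv_htpy]), and a loop at p
    represents an element of the H-class of p ([pi1_PG_Hclass]).

    Finally, every element e of PG(P) has a right inverse up to the
    projection p at its start ([PG_right_inverse]), so an idempotent e is
    R-related to p, and right multiplication by e carries the H-class of p
    isomorphically onto that of e ([group_iso_sub_Hclass]). *)

Set Implicit Arguments.
Unset Strict Implicit.
Unset Printing Implicit Defensive.

Local Open Scope group_scope.
Local Open Scope quotient_scope.

(** * Category congruences *)

Section Congruence.
Variables (T : choiceType) (r : rel T) (G : seq T -> seq T -> Prop).

Lemma cgen_catr a b x c : is_walk r (x :: c) ->
  cgen r G (rcons a x) (rcons b x) -> cgen r G (rcons a x ++ c) (rcons b x ++ c).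
Proof. by move=> hc h; apply: cgen_comp => //; apply: cgen_refl. Qed.

Lemma cgen_catl a x c d : is_walk r (rcons a x) ->
  cgen r G (x :: c) (x :: d) -> cgen r G (rcons a x ++ c) (rcons a x ++ d).
Proof. by move=> ha h; apply: cgen_comp => //; apply: cgen_refl. Qed.

Lemma cgen_sub (r' : rel T) (G' : seq T -> seq T -> Prop) s t :
  subrel r r' -> (forall u v, G u v -> cgen r' G' u v) ->
  cgen r G s t -> cgen r' G' s t.
Proof.
move=> rr' GG'; elim=> {s t} [s t /GG'//|s /andP[s0 hs]|s t _|s t u _ h _|].
- apply: cgen_refl; rewrite /is_walk s0 /=; exact: sub_sorted hs.
- exact: cgen_sym.
- exact: cgen_trans.
- by move=> a b x c d _ h _ k; apply: cgen_comp.
Qed.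

End Congruence.

(** * Removing constant steps from P-paths *)

Section Unstutter.
Variable P : projAlgebraType.
Implicit Types (p q e f v w x : P) (s t a b c d : seq P).

Definition unstutter s : seq P :=
  if s is v :: t then v :: nostutter v t else [::].

Lemma nostutter_cat v s t :
  nostutter v (s ++ t) = nostutter v s ++ nostutter (last v s) t.
Proof.
elim: s v => //= w s IH v; case: eqP => [->|_]; first exact: IH.
by rewrite cat_cons IH.
Qed.

Lemma unstutter_cat a x c :
  unstutter (rcons a x ++ c) = unstutter (rcons a x) ++ nostutter x c.
Proof.
case: a => [|y a] //=.
by rewrite nostutter_cat last_rcons.
Qed.

(** The last vertex survives, so unstuttered paths can still be composed there. *)
Lemma unstutter_rcons a x : exists a', unstutter (rcons a x) = rcons a' x.
Proof.
elim/last_ind: a x => [|a y IH] x; first by exists [::].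
rewrite -cats1 unstutter_cat /=; case: eqP => [->|_].
  by rewrite cats0; apply: IH.
by exists (unstutter (rcons a y)); rewrite cats1.
Qed.

Lemma unstutter_walk s : is_walk (@pF P) s -> is_walk (@GP_edge P) (unstutter s).
Proof. by case: s => // v s /nostutter_path /andP[]. Qed.

Lemma nostutter_id v s : path (@GP_edge P) v s -> nostutter v s = s.
Proof.
elim: s v => //= w s IH v /andP[/andP[vw _] /IH ->].
by rewrite eq_sym (negPf vw).
Qed.

Lemma unstutter_id s : is_walk (@GP_edge P) s -> unstutter s = s.
Proof. by case: s => //= v s /nostutter_id ->. Qed.

Lemma GP_edge_pF : subrel (@GP_edge P) (@pF P).
Proof. by move=> x y /andP[]. Qed.

Lemma apx_unstutter s : is_walk (@pF P) s -> apx s (unstutter s).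
Proof.
case: s => // v s; elim: s v => [|w s IH] v; first exact: cgen_refl.
move=> /andP[_ /= /andP[vw hs]]; have {}IH := IH w hs.
case: eqP => [E|_].
  rewrite -{v}E in vw *; apply: cgen_trans IH.
  apply: (@cgen_catr _ _ _ [:: w] [::] w s) => //.
  exact/cgen_base/apx_id.
apply: (@cgen_catl _ _ _ [:: v] w) => //.
by rewrite /is_walk /= vw.
Qed.

(** * Linked pairs *)

Lemma apx_back2 e f g : pF e g -> pF g f -> apx [:: e; g; f; g; e] [:: e].
Proof.
move=> eg gf; apply: (@cgen_trans _ _ _ _ [:: e; g; e]).
  apply: (@cgen_catr _ _ _ [:: e; g; f] [:: e] g [:: e]).
    by rewrite /is_walk /= pF_sym eg.
  apply: (@cgen_catl _ _ _ [::] e [:: g; f; g] [:: g]) => //.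
  apply: (@cgen_catl _ _ _ [:: e] g [:: f; g] [::]).
    by rewrite /is_walk /= eg.
  exact/cgen_base/apx_back.
exact/cgen_base/apx_back.
Qed.

Lemma apx_eqv s t : apx s t -> eqv s t.
Proof. by apply: cgen_sub => // u v /eqv_apx h; apply: cgen_base. Qed.

(** Running along the relation for a linked pair turns its square into the
    doubled backtrack e, f', f, f', e. *)
Lemma linked_square p e f : linked p e f ->
  eqv [:: e; e \th_p; f; f \th_p; e] [:: e].
Proof.
move=> h; have h' : linked p f e by rewrite linked_sym.
apply: (@cgen_trans _ _ _ _ [:: e; f \th_p; f; f \th_p; e]).
  apply: (@cgen_catr _ _ _ [:: e; e \th_p] [:: e; f \th_p] f [:: f \th_p; e]).
    exact: lam_walk h'.
  exact/cgen_base/eqv_linked.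
apply/apx_eqv/apx_back2; first by rewrite pF_sym (linked_F2 h').
by rewrite pF_sym (linked_F1 h').
Qed.

(** The two special pairs whose triangles share the diagonal e' - f' and fill the
    square of (e, f). *)
Lemma linked_special p e f : linked p e f ->
  [/\ linked p (e \th_p) f, special p (e \th_p) f,
      linked p e (f \th_p) & special p e (f \th_p)].
Proof.
have aux u v : linked p u v -> linked p (u \th_p) v.
  move=> /linkedP[hv hu]; apply/linkedP; rewrite act_idem; split=> //.
  by rewrite -act_conj act_idem -hu.
move=> h; split; [exact: aux| |rewrite linked_sym; apply: aux|].
- by rewrite /special ple_act.
- by rewrite linked_sym.
- by rewrite /special ple_act orbT.
Qed.

(** * The product of PG(P) on composable paths *)

Lemma prodr_id v c : path (@pF P) v c -> prodr v c = c.
Proof.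
elim: c v => //= w c IH v /andP[/pFP[_ <-] /IH E].
by rewrite /prodr /= -/(prodr w c) E.
Qed.

(** When the first path ends where the second starts, both projections p' and q'
    of the product are the common vertex, and since F-related neighbours satisfy
    p = q \th_p the action leaves the two paths unchanged. *)
Lemma prods_join a v c : is_walk (@pF P) (rcons a v) -> path (@pF P) v c ->
  prods (rcons a v) (v :: c) = rcons a v ++ v :: c.
Proof.
rewrite -is_walk_rev rev_rcons => /andP[_ /= ha] hc.
rewrite prods_act /prodl rev_rcons !prodr_cons /ple ?act_id //.
by rewrite !prodr_id // rev_cons revK.
Qed.

Lemma PG_eqP (s t : ppath P) :
  reflect (eqv s t) (\pi_(PG P) s == \pi_(PG P) t).
Proof.
by apply: (iffP eqP) => [/eqmodP/asboolP//|h]; apply/eqmodP/asboolP.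
Qed.

Lemma PG_mul_join a v c (s t u : ppath P) :
  ppath_seq s = rcons a v -> ppath_seq t = v :: c -> ppath_seq u = rcons a v ++ c ->
  \pi_(PG P) s * \pi_(PG P) t = \pi_(PG P) u.
Proof.
move=> Es Et Eu; rewrite [LHS]PG_mul_pi; apply/eqP/PG_eqP.
have hs := ppathP s; have ht := ppathP t; have hu := ppathP u.
rewrite /= Es Et Eu in hs ht hu *; rewrite prods_join //.
apply: cgen_catl => //; apply: (@cgen_catr _ _ _ [:: v] [::] v c) => //.
exact/cgen_base/eqv_apx/apx_id.
Qed.

(** The outer vertices of a product are the last values computed by the action,
    so they lie in the image of the corresponding operation \th. *)
Lemma prods_ends s t z : is_walk (@pF P) s -> is_walk (@pF P) t ->
  ple (head z (prods s t)) (head z s) /\ ple (last z (prods s t)) (last z t).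
Proof.
case: s => // v s _; case: t => // w t _; split.
  by rewrite /= /prodl rev_cons prodr_rcons rev_rcons /= foldl_rcons ple_act.
rewrite last_cat; have [c [x ->]] : exists c x, w :: t = rcons c x.
  by exists (belast w t), (last w t); rewrite -lastI.
by rewrite prodr_rcons !last_rcons foldl_rcons ple_act.
Qed.

Lemma ple_anti p q : ple p q -> ple q p -> p = q.
Proof. by move=> /pleP h1 /pleP h2; rewrite [LHS]h1 -act_swap -h2 act_id. Qed.

(** An element s of the H-class satisfies p s = s and s t = p; by [prods_ends] the
    first puts the start of s below p, the second p below the start of s.  The
    end is symmetric. *)
Lemma Hclass_proj_ends p (s : ppath P) : Hclass (PG_proj p) (\pi_(PG P) s) ->
  head p s = p /\ last p s = p.
Proof.
rewrite /PG_proj; set e := PPath _; case=> [hr [hl]] [y].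
elim/quotW: y => t [hst hts]; move: hr hl hst hts.
rewrite ![_ * _]PG_mul_pi => /eqP/PG_eqP/eqv_ends[_ _ /(_ p)[_ hr]].
move=> /eqP/PG_eqP/eqv_ends[_ _ /(_ p)[hl _]].
move=> /eqP/PG_eqP/eqv_ends[_ _ /(_ p)[hst _]].
move=> /eqP/PG_eqP/eqv_ends[_ _ /(_ p)[_ hts]].
split; apply: ple_anti.
- by rewrite -hl; have [] := prods_ends p (ppathP e) (ppathP s).
- have [] := prods_ends p (ppathP s) (ppathP t); rewrite -/(ppath_prod s t).
  by rewrite [head _ _]hst.
- by rewrite -hr; have [] := prods_ends p (ppathP s) (ppathP e).
- have [_] := prods_ends p (ppathP t) (ppathP s).
  by rewrite [last _ _]hts.
Qed.

(** * Homotopy in a complex on G_P and equality in PG(P) *)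

(** K_P and K_P' have the same 1-skeleton and their cells are squares of linked
    pairs, so both are handled by one complex with cells b.  All that matters is
    that each cell comes from a linked pair and that the nondegenerate special
    pairs have a cell. *)

Section Skeleton.
Variables (C : Type) (b : C -> seq P).
Hypothesis bP : forall z, is_closed_walk (@GP_edge P) (b z).

Local Notation K := (Complex2 (@GP_edge_sym P) (@GP_edge_irr P) bP).
Local Notation htpyK := (cgen (@GP_edge P) (@htpy_gen K)).

Lemma htpy_unstutter_comp a a' x c d :
  htpyK (unstutter (rcons a x)) (unstutter (rcons a' x)) ->
  htpyK (unstutter (x :: c)) (unstutter (x :: d)) ->
  htpyK (unstutter (rcons a x ++ c)) (unstutter (rcons a' x ++ d)).
Proof.
rewrite !unstutter_cat; have [{}a ->] := unstutter_rcons a x.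
have [{}a' ->] := unstutter_rcons a' x; exact: cgen_comp.
Qed.

Lemma htpy_unstutter (G : seq P -> seq P -> Prop) s t :
  (forall c d, G c d -> htpyK (unstutter c) (unstutter d)) ->
  cgen (@pF P) G s t -> htpyK (unstutter s) (unstutter t).
Proof.
move=> hG; elim=> {s t} [s t /hG//|s hs|s t _|s t u _ h _|].
- exact/cgen_refl/unstutter_walk.
- exact: cgen_sym.
- exact: cgen_trans.
- by move=> a a' x c d _ h _ k; apply: htpy_unstutter_comp.
Qed.

Lemma apx_gen_htpy s t : apx_gen s t -> htpyK (unstutter s) (unstutter t).
Proof.
case=> [p|p q pq] /=; first by rewrite eqxx; apply: cgen_refl.
case: (eqVneq q p) => [_|qp]; first by rewrite eqxx; apply: cgen_refl.
apply/cgen_base/(@htpy_back K p q).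
by rewrite /= /GP_edge eq_sym qp.
Qed.

Lemma apx_htpy s t : apx s t -> htpyK (unstutter s) (unstutter t).
Proof. exact/htpy_unstutter/apx_gen_htpy. Qed.

(** Both halves of the square are homotopic to the full turn
    (e, e', f, f', e, f', f): its tail f, f', e, f', f backtracks, and its head is
    the boundary of the cell. *)
Lemma cell_htpy p e f : linked p e f ->
  (exists z, b z = unstutter [:: e; e \th_p; f; f \th_p; e]) ->
  htpyK (unstutter (lam e p f)) (unstutter (rho e p f)).
Proof.
move=> h [c hc]; have h' : linked p f e by rewrite linked_sym.
have wrho := rho_walk h.
apply: (@cgen_trans _ _ _ _
  (unstutter [:: e; e \th_p; f; f \th_p; e; f \th_p; f])).
  apply/cgen_sym/apx_htpy.
  apply: (@cgen_catl _ _ _ [:: e; e \th_p] f [:: f \th_p; e; f \th_p; f] [::]).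
    exact: lam_walk.
  by apply: apx_back2; [exact: (linked_F1 h')|exact: (linked_F2 h')].
(* Split the full turn after the boundary of the cell. *)
apply: (@htpy_unstutter_comp [:: e; e \th_p; f; f \th_p] [::] e
  [:: f \th_p; f] [:: f \th_p; f]).
  exact/cgen_base/(@htpy_cell K c).
exact/cgen_refl/unstutter_walk.
Qed.

Hypothesis cells_linked : forall z, exists p e f,
  linked p e f /\ b z = unstutter [:: e; e \th_p; f; f \th_p; e].

Lemma htpy_eqv s t : htpyK s t -> eqv s t.
Proof.
apply: cgen_sub; first exact: GP_edge_pF.
move=> u v [x y /andP[_ xy]|c x w hc]; first exact/cgen_base/eqv_apx/apx_back.
have [p [e [f [h E]]]] := cells_linked c.
have Ex : e = x by move: hc; rewrite [LHS]E => -[].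
rewrite -{x}Ex in hc *.
rewrite -hc [bdry _]E.
apply: cgen_trans (linked_square h); apply/cgen_sym/apx_eqv/apx_unstutter.
have h' : linked p f e by rewrite linked_sym.
by rewrite /is_walk /= (linked_F1 h) (linked_F2 h) (linked_F1 h') (linked_F2 h').
Qed.

Hypothesis special_cells : forall p e f,
  linked p e f -> special p e f -> ~ degenerate p e f ->
  exists z, b z = unstutter [:: e; e \th_p; f; f \th_p; e].

(** The square is cut along its diagonal: (e, e', f) is moved to (e, e', f', f)
    across one special triangle and then to (e, f', f) across the other. *)
Lemma linked_htpy p e f : linked p e f ->
  htpyK (unstutter (lam e p f)) (unstutter (rho e p f)).
Proof.
have hsp u v : linked p u v -> special p u v ->
    htpyK (unstutter (lam u p v)) (unstutter (rho u p v)).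
  move=> l sp; have [/apx_htpy //|nd] := pselect (degenerate p u v).
  exact: cell_htpy l (special_cells l sp nd).
move=> h; have [h1 s1 h2 s2] := linked_special h.
have h' : linked p f e by rewrite linked_sym.
apply: (@cgen_trans _ _ _ _ (unstutter [:: e; e \th_p; f \th_p; f])).
  apply: (@htpy_unstutter_comp [:: e] [:: e] _ [:: f] [:: f \th_p; f]).
    by apply/cgen_refl/unstutter_walk; rewrite /is_walk /= (linked_F1 h).
  by have := hsp _ _ h1 s1; rewrite /lam /rho act_idem /= eqxx.
apply: (@htpy_unstutter_comp [:: e; e \th_p] [:: e] _ [:: f] [:: f]).
  have := hsp _ _ h2 s2; rewrite /lam /rho act_idem.
  have -> : unstutter [:: e; f \th_p; f \th_p] = unstutter [:: e; f \th_p].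
    by rewrite /= eqxx; case: eqP.
  by [].
apply/cgen_refl/unstutter_walk.
by rewrite /is_walk /= pF_sym (linked_F1 h').
Qed.

Lemma eqv_htpy s t : eqv s t -> htpyK (unstutter s) (unstutter t).
Proof.
apply: htpy_unstutter => u v [{}u {}v /apx_gen_htpy//|p e f]; exact: linked_htpy.
Qed.

(** * Fundamental groups as H-classes of projections *)

Section BasePoint.
Variable p : P.

Lemma loop_pwalk (s : @loop K p) : is_walk (@pF P) (p :: s).
Proof. by have /andP[h _] := loopP s; apply: sub_path h; apply: GP_edge_pF. Qed.

Definition loop_ppath (s : @loop K p) : ppath P := PPath (loop_pwalk s).

Definition pi1_PG (x : pi1 K p) : PG P := \pi_(PG P) (loop_ppath (repr x)).

Lemma pi1_eqP (s t : @loop K p) :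
  reflect (eqv (p :: s) (p :: t)) (\pi_(pi1 K p) s == \pi_(pi1 K p) t).
Proof.
apply: (iffP eqP) => [/eqmodP/asboolP/htpy_eqv//|h].
have walk (u : @loop K p) : is_walk (@GP_edge P) (p :: u).
  by have /andP[] := loopP u.
apply/eqmodP/asboolP.
by rewrite -[p :: s]unstutter_id // -[p :: t]unstutter_id //; apply: eqv_htpy.
Qed.

Lemma pi1_PG_pi (s : @loop K p) :
  pi1_PG (\pi_(pi1 K p) s) = \pi_(PG P) (loop_ppath s).
Proof. by apply/eqP/PG_eqP/pi1_eqP; rewrite reprK. Qed.

Lemma pi1_PG_inj : injective pi1_PG.
Proof.
elim/quotW => s; elim/quotW => t; rewrite !pi1_PG_pi => /eqP/PG_eqP h.
exact/eqP/pi1_eqP.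
Qed.

Lemma pi1_PG_morph : {morph pi1_PG : x y / x * y}.
Proof.
elim/quotW => s; elim/quotW => t.
have -> : \pi_(pi1 K p) s * \pi_(pi1 K p) t = \pi_(pi1 K p) (loopM s t).
  exact: pi1_mul_pi.
rewrite !pi1_PG_pi; apply/esym/(@PG_mul_join (belast p s) p t) => //=.
  by have := loopE s.
exact: (congr1 (cat^~ t) (loopE s)).
Qed.

HB.instance Definition _ := isMultiplicative.Build _ _ pi1_PG pi1_PG_morph.

Lemma pi1_PG1 : pi1_PG 1 = PG_proj p.
Proof. by rewrite pi1_PG_pi; congr (\pi_(PG P) _); apply: val_inj. Qed.

(** Surjectivity: an element of the H-class is represented by a closed P-path at
    p, and removing its constant steps makes it an edge loop. *)
Lemma pi1_PG_Hclass : group_iso_sub (pi1 K p) (Hclass (PG_proj p)).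
Proof.
exists pi1_PG; split=> [x _|x y _ _|]; last first.
- elim/quotW => s hs; have [hd lst] := Hclass_proj_ends hs.
  have [c Ec] : exists c, val s = p :: c.
    by case: s hd {hs lst} => -[|q c] // hw /= <-; exists c.
  have hc : path (@pF P) p c by have := ppathP s; rewrite [ppath_seq s]Ec.
  have lc : last p c = p by have := lst; rewrite [ppath_seq s]Ec.
  have hu : path (@GP_edge P) p (nostutter p c) && (last p (nostutter p c) == p).
    by have := nostutter_path hc; rewrite lc.
  exists (\pi_(pi1 K p) (@Loop K p _ hu)) => //; rewrite [LHS]pi1_PG_pi.
  apply/eqP/PG_eqP/cgen_sym; rewrite [ppath_seq s]Ec.
  exact/apx_eqv/(@apx_unstutter (p :: c)).
- exact: pi1_PG_inj.
- rewrite /Hclass/= -pi1_PG1 -!pi1_PG_morph mulg1 mul1g; do 2!split => //.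
  by exists (pi1_PG x^-1); rewrite -!pi1_PG_morph mulgV mulVg.
Qed.

End BasePoint.

End Skeleton.
End Unstutter.

(** * The complexes K_P and K_P' *)

Section TwoComplexes.
Variable P : projAlgebraType.

Lemma KP_cells_linked (z : cell (KP P)) : exists p e f,
  linked p e f /\ bdry z = unstutter [:: e; e \th_p; f; f \th_p; e].
Proof. by case: z => p e f h; exists p, e, f. Qed.

Lemma KP_PG p : group_iso_sub (pi1 (KP P) p) (Hclass (PG_proj p)).
Proof.
apply: pi1_PG_Hclass => [|q e f h _ _]; first exact: KP_cells_linked.
by exists (LinkedPair h).
Qed.

Lemma KP'_PG p : group_iso_sub (pi1 (KP' P) p) (Hclass (PG_proj p)).
Proof.
apply: pi1_PG_Hclass => [z|q e f h sp nd]; first exact: KP_cells_linked.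
by exists (exist _ (LinkedPair h) (conj sp nd)).
Qed.

(** The projection p is the start of a path representing x, and y is the reversed
    path.  That a path followed by its reverse contracts is known for edge paths
    in any complex, in particular in K_P. *)
Lemma PG_right_inverse (x : PG P) :
  exists p y, PG_proj p * x = x /\ x * y = PG_proj p.
Proof.
elim/quotW: x => s; case: s => -[|v c] // hs.
have /andP[_ hn] := unstutter_walk hs; have wn := sub_path (@GP_edge_pF P) hn.
set c' := nostutter v c in hn wn.
have -> : \pi_(PG P) (PPath hs) = \pi_(PG P) (@PPath P (v :: c') wn).
  exact/eqP/PG_eqP/apx_eqv/(@apx_unstutter P (v :: c)).
have wr : is_walk (@pF P) (rev (v :: c')) by rewrite is_walk_rev.
have hc : eqv ((v :: c') ++ rev (belast v c')) [:: v].
  have <- : behead (rev (v :: c')) = rev (belast v c') by rewrite lastI rev_rcons.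
  exact: @htpy_eqv P _ _ (@KP_bdryP P) KP_cells_linked _ _ (htpy_cancel (K := KP P) hn).
have [wc _ _] := eqv_ends hc.
exists v, (\pi_(PG P) (PPath wr)); split.
  exact: (@PG_mul_join P [::] v c').
rewrite (@PG_mul_join P (belast v c') (last v c') (rev (belast v c'))
  _ _ (PPath wc)).
- exact/eqP/PG_eqP.
- exact: lastI.
- by rewrite /= lastI rev_rcons.
- by rewrite [LHS]/= -cat_cons lastI.
Qed.

End TwoComplexes.

(** * Transport of H-classes between R-related idempotents *)

Section HClassTransport.
Variable S : semigroupType.

(** The hypotheses say that e and p are idempotents with the same right ideal;
    if y inverts x in the H-class of p then p y e inverts x e. *)
Lemma Hclass_mulr (e p x : S) : p * e = e -> e * p = p ->
  Hclass p x -> Hclass e (x * e).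
Proof.
move=> pe ep [xp [px [y [xy yx]]]].
have ee : e * e = e by rewrite -[X in _ * X]pe mulgA ep pe.
have ex : e * x = x by rewrite -px mulgA ep.
split; first by rewrite -mulgA ee.
split; first by rewrite mulgA ex.
exists (p * y * e); split.
  by rewrite -!mulgA (mulgA e) ep (mulgA x) xp (mulgA x) xy pe.
by rewrite -!mulgA (mulgA e) ex (mulgA y) yx !pe.
Qed.

(** Right multiplication by p undoes right multiplication by e. *)
Lemma group_iso_sub_Hclass (G : groupType) (e p : S) : p * e = e -> e * p = p ->
  group_iso_sub G (Hclass p) -> group_iso_sub G (Hclass e).
Proof.
move=> pe ep [f [fH fI fS]]; pose g x : S := f x * e.
have pf x : p * f x = f x by have [_ []] := fH x I.
have fp x : f x * p = f x by have [] := fH x I.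
have gM : {morph g : x y / x * y}.
  move=> x y; rewrite /g gmulfM mulgA -[f x * e * _]mulgA.
  by rewrite -{2}[f y]pf (mulgA e) ep pf.
pose gm := isMultiplicative.Build G S g gM.
exists (HB.pack_for {multiplicative G -> S} g gm); split.
- by move=> x _; apply: Hclass_mulr pe ep (fH x I).
- move=> x y _ _ /(congr1 (fun z => z * p)); rewrite /= /g -!mulgA ep !fp.
  by apply: fI; rewrite inE.
- move=> z hz; have := Hclass_mulr ep pe hz; move=> /fS[x _ E]; exists x => //.
  by rewrite /= /g E -mulgA pe; case: hz.
Qed.

Lemma group_iso_of_sub (G H : groupType) (A : set S) :
  group_iso_sub G A -> group_iso_sub H A -> group_iso G H.
Proof.
move=> [f [fA fI fS]] [g [gA gI gS]].
have finj : injective f by move=> x y; apply: fI; rewrite inE.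
have ginj : injective g by move=> x y; apply: gI; rewrite inE.
have [h hE] : {h : G -> H & forall x, g (h x) = f x}.
  apply: (@choice _ _ (fun x y => g y = f x)) => x.
  by have [y _ <-] := gS _ (fA x I); exists y.
have [k kE] : {k : H -> G & forall y, f (k y) = g y}.
  apply: (@choice _ _ (fun y x => f x = g y)) => y.
  by have [x _ <-] := fS _ (gA y I); exists x.
have hM : {morph h : x y / x * y} by move=> x y; apply: ginj; rewrite gmulfM !hE gmulfM.
pose hm := isMultiplicative.Build G H h hM.
exists (HB.pack_for {multiplicative G -> H} h hm).
exists k => [x|y]; first by apply: finj; rewrite kE hE.
by apply: ginj; rewrite hE kE.
Qed.

End HClassTransport.

Theorem theorem10p7 (P : projAlgebraType) :
  (forall A : set (PG P), maximal_subgroup A ->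
     exists p : P,
       group_iso_sub (pi1 (KP P) p) A /\ group_iso_sub (pi1 (KP' P) p) A) /\
  (forall p : P,
     group_iso_sub (pi1 (KP P) p) (Hclass (PG_proj p)) /\
     group_iso (pi1 (KP P) p) (pi1 (KP' P) p)).
Proof.
split=> [A [e ee ->]|p]; last first.
  by split; [exact: KP_PG|exact: group_iso_of_sub (KP_PG p) (KP'_PG p)].
have [p [y [pe ey]]] := PG_right_inverse e.
have ep : e * PG_proj p = PG_proj p by rewrite -ey mulgA ee.
exists p; split; apply: (group_iso_sub_Hclass pe ep); [exact: KP_PG|exact: KP'_PG].
Qed.
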